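(* Let $\epsilon$ be a ground set orientation and let all duals be canonical duals with respect to $\epsilon$ (taken relative to the ground set of the extensor being dualized). (1) For extensors $\mathbf{N}_1,\mathbf{N}_2$ with ground set $S$ such that $\mathbf{N}_1+\mathbf{N}_2$ is an extensor, and $\alpha\in K$: $(\mathbf{N}_1+\mathbf{N}_2)^\perp=\mathbf{N}_1^\perp+\mathbf{N}_2^\perp$ and $(\alpha\mathbf{N})^\perp=\alpha\mathbf{N}^\perp$. (2) For an extensor $\mathbf{N}$ with ground set $S$: $\mathbf{N}^{\perp\perp}=(-1)^{\rho\mathbf{N}\,(|S|-\rho\mathbf{N})}\mathbf{N}=(-1)^{\rho\mathbf{N}\,\rho\mathbf{N}^\perp}\mathbf{N}$. (3) For an extensor $\mathbf{N}$ with ground set $S$, a sequence $X$ of distinct elements of $S$, and $S'=S\setminus X$ written in any sequence: \[(\mathbf{N}\setminus X)^\perp=\epsilon(S')\epsilon(S'X)\,(\mathbf{N}^\perp/X),\qquad (\mathbf{N}/X)^\perp=\epsilon(S')\epsilon(S'X)(-1)^{|X|(|S|-\rho\mathbf{N})}\,(\mathbf{N}^\perp\setminus X).\] (4) For extensors $\mathbf{N}_1,\mathbf{N}_2$ with disjoint ground sets $S_1,S_2$, the product $\mathbf{N}_1\mathbf{N}_2$ (an extensor with ground set $S_1\sqcup S_2$) presents the (oriented) matroid direct sum of the (oriented) matroids presented by $\mathbf{N}_1$ and $\mathbf{N}_2$, and \[(\mathbf{N}_1\mathbf{N}_2)^\perp=\epsilon(S_1)\epsilon(S_2)\epsilon(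S_1S_2)(-1)^{\rho\mathbf{N}_1^\perp\,\rho\mathbf{N}_2}\,\mathbf{N}_1^\perp\mathbf{N}_2^\perp.\]
   Context: $K$ is a field. For a finite set $S$, $\mathcal{E}(KS)$ is the exterior algebra over $KS$ with basis $S$; $\mathbf{s}$ is the image of $s\in S$. For a sequence $A=a_1\cdots a_k$ of distinct elements, $\mathbf{A}=\mathbf{a}_1\cdots\mathbf{a}_k$ ($\mathbf{1}$ if empty). A set symbol denotes its elements listed in an arbitrary sequence; $AB$ is concatenation; $\bar{X}$ denotes $S\setminus X$ in an arbitrary sequence. An extensor with ground set $S$ is an element of $\mathcal{E}(KS)$ that is a scalar multiple of $\mathbf{1}$ or an exterior product of vectors of $KS$. Its Plücker coordinates are the unique alternating function $A\mapsto\mathbf{N}[A]$ on sequences over $S$ with $\mathbf{N}=\sum_{A\subseteq S}\mathbf{N}[A]\mathbf{A}$. If $\mathbf{N}\ne0$, all sequences with nonzero coordinate have a common length $\rho\mathbf{N}$ (the rank); the sets $B$ with $\mathbf{N}[B]\neq 0$ are the bases of the matroid presented by $\mathbf{N}$, and the signs of $\mathbf{N}[B]$ give the chirotope of the oriented matroid presented by $\mathbf{N}$. Deletion/contraction: $(\mathbf{N}\setminus e)[B]=\mathbf{N}[B]$, $(\mathbf{N}/e)[B]=\mathbf{N}[Be]$ (ground set $S\setminus e$); for a sequence $X=x_1\cdots x_k$, $\mathbf{N}/X=\mathbf{N}/x_k/\cdots/x_1$ (so $(\mathbf{N}/X)[Y]=\mathbf{N}[YX]$) and $\mathbf{N}\setminus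 X$ is defined likewise. A ground set orientation is an alternating function $\epsilon$ from finite sequences of ground set elements to $\{1,-1,0\}$, nonzero on sequences of distinct elements, with $\epsilon(\emptyset)=1$. The canonical dual of $\mathbf{N}$ (ground set $S$) is the extensor $\mathbf{N}^\perp$ with ground set $S$ and $\mathbf{N}^\perp[X]=\mathbf{N}[\bar{X}]\,\epsilon(\bar{X}X)$ (independent of the sequence chosen for $\bar X$). *)

(* Defs.v *)
From HB Require Import structures.
From mathcomp Require Import all_boot all_order all_algebra.
From mathcomp Require Import zify.

Set Implicit Arguments.
Unset Strict Implicit.
Unset Printing Implicit Defensive.

Import Order.TTheory GRing.Theory Num.Theory.
Local Open Scope ring_scope.

(* E(KT), in the basis of the increasing products e_A of the elements of A
   ("increasing" for the enumeration order of T): u A is the coefficient of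
   e_A, and e_A e_B = (-1)^(ninv A B) e_(A :|: B) if A, B are disjoint, else 0.
   All ground sets are subsets of T, and E(KS) is the subalgebra of E(KT)
   generated by S. *)
Definition exterior (K : comNzRingType) (T : finType) : Type :=
  {ffun {set T} -> K}.

Section Exterior.
Variables (K : comNzRingType) (T : finType).
Local Notation E := (exterior K T).
Implicit Types (A B C S : {set T}) (x y : T) (s t X : seq T).

HB.instance Definition _ := GRing.Lmodule.copy E {ffun {set T} -> K^o}.
HB.instance Definition _ := Choice.copy E {ffun {set T} -> K}.

Implicit Types (u v w : E).

Definition ninv A B : nat :=
  (\sum_(a in A) \sum_(b in B) (enum_rank b < enum_rank a))%N.

Definition ext_mul u v : E :=
  [ffun A : {set T} =>
     \sum_(B : {set T} | B \subset A)
       (-1) ^+ ninv B (A :\: B) * (u B * v (A :\: B))].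

Definition ext_one : E := [ffun A : {set T} => (A == set0)%:R].

Lemma sum_setU A B (F : T -> nat) : [disjoint A & B] ->
  (\sum_(x in A :|: B) F x = \sum_(x in A) F x + \sum_(x in B) F x)%N.
Proof. by move=> dAB; rewrite -bigU //=; apply: eq_bigl => x; rewrite !inE. Qed.

Lemma ninvUl A B C : [disjoint A & B] ->
  ninv (A :|: B) C = (ninv A C + ninv B C)%N.
Proof. by move=> dAB; rewrite /ninv sum_setU. Qed.

Lemma ninvUr A B C : [disjoint B & C] ->
  ninv A (B :|: C) = (ninv A B + ninv A C)%N.
Proof.
move=> dBC; rewrite /ninv -big_split /=; apply: eq_bigr => a _.
by rewrite sum_setU.
Qed.

Lemma ninv0l A : ninv set0 A = 0%N.
Proof. by rewrite /ninv big_set0. Qed.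

Lemma ninv0r A : ninv A set0 = 0%N.
Proof. by rewrite /ninv big1 // => a _; rewrite big_set0. Qed.

Fact ext_mulA : associative ext_mul.
Proof.
move=> u v w; apply/ffunP => A; rewrite !ffunE.
under eq_bigr => B sBA do rewrite ffunE mulr_sumr mulr_sumr.
under [RHS]eq_bigr => D sDA do rewrite ffunE mulr_suml mulr_sumr.
rewrite [RHS](exchange_big_dep (fun B => B \subset A)) /=; last first.
  by move=> D B sDA sBD; apply: subset_trans sBD sDA.
apply: eq_bigr => B sBA.
rewrite [RHS](reindex_onto (fun C => B :|: C) (fun D => D :\: B)) /=; last first.
  move=> D /andP[_ /setUidPr sBD].
  by rewrite setDE setUIr setUCr setIT sBD.
have eqP C : (C \subset A :\: B) =
    ((B :|: C \subset A) && (B \subset B :|: C) && ((B :|: C) :\: B == C)).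
  rewrite subsetD subUset sBA subsetUl /= andbT.
  case: (C \subset A) => //=; rewrite setDUl setDv set0U.
  by apply/idP/eqP => [/setDidPl|/setDidPl].
rewrite (eq_bigl _ _ eqP); apply: eq_bigr => C; rewrite -eqP => sC.
have [sCA dCB] : C \subset A /\ [disjoint C & B].
  by apply/andP; rewrite -subsetD.
have -> : (B :|: C) :\: B = C by rewrite setDUl setDv set0U; apply/setDidPl.
rewrite -setDDl; set D := (A :\: B) :\: C.
have dCD : [disjoint C & D].
  by rewrite disjoint_sym /D -setI_eq0 setIC setIDA setIC -setIDA setDv setI0.
rewrite ninvUl 1?disjoint_sym //.
have -> : A :\: B = C :|: D.
  by rewrite -[LHS](setID _ C) (setIidPr sC).
rewrite ninvUr // !exprD -!mulrA [LHS]mulrCA; congr (_ * _).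
by rewrite [RHS]mulrCA; congr (_ * _); rewrite mulrCA.
Qed.

Fact ext_mul1 : left_id ext_one ext_mul.
Proof.
move=> u; apply/ffunP => A; rewrite ffunE (bigD1 set0) ?sub0set //=.
rewrite big1 => [|B /andP[_ /negPf nB]]; last by rewrite ffunE nB mul0r mulr0.
by rewrite ffunE eqxx setD0 ninv0l expr0 !mul1r addr0.
Qed.

Fact ext_mulr1 : right_id ext_one ext_mul.
Proof.
move=> u; apply/ffunP => A; rewrite ffunE (bigD1 A) ?subxx //=.
rewrite big1 => [|B /andP[sBA nB]].
  by rewrite ffunE setDv eqxx ninv0r expr0 mul1r mulr1 addr0.
rewrite ffunE setD_eq0; case: (boolP (A \subset B)) => [sAB|_].
  by rewrite eqEsubset sBA sAB in nB.
by rewrite !mulr0.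
Qed.

Fact ext_mulDl : left_distributive ext_mul +%R.
Proof.
move=> u v w; apply/ffunP => A; rewrite !ffunE -big_split; apply: eq_bigr => B _.
by rewrite !ffunE mulrDl mulrDr.
Qed.

Fact ext_mulDr : right_distributive ext_mul +%R.
Proof.
move=> u v w; apply/ffunP => A; rewrite !ffunE -big_split; apply: eq_bigr => B _.
by rewrite !ffunE !mulrDr.
Qed.

Fact ext_one_neq0 : ext_one != 0.
Proof.
by apply/eqP => /ffunP/(_ set0)/eqP; rewrite !ffunE eqxx oner_eq0.
Qed.

HB.instance Definition _ := GRing.Zmodule_isNzRing.Build E
  ext_mulA ext_mul1 ext_mulr1 ext_mulDl ext_mulDr ext_one_neq0.

Fact ext_scalerAl (a : K) u v : a *: (u * v) = (a *: u) * v.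
Proof.
apply/ffunP => A; rewrite !ffunE scaler_sumr; apply: eq_bigr => B _.
by rewrite !ffunE [LHS]mulrCA -[in RHS]mulrA.
Qed.

HB.instance Definition _ := GRing.Lmodule_isLalgebra.Build K E ext_scalerAl.

Fact ext_scalerAr (a : K) u v : a *: (u * v) = u * (a *: v).
Proof.
apply/ffunP => A; rewrite !ffunE scaler_sumr; apply: eq_bigr => B _.
by rewrite !ffunE [LHS]mulrCA [a * _]mulrCA.
Qed.

HB.instance Definition _ := GRing.Lalgebra_isAlgebra.Build K E ext_scalerAr.

Definition ext_basis A : E := [ffun B : {set T} => (B == A)%:R].

Definition gen x : E := ext_basis [set x].

Definition bold s : E := \prod_(x <- s) gen x.

(* v is a vector of KS *)
Definition is_vector S v : Prop :=
  exists c : T -> K, v = \sum_(x in S) c x *: gen x.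

Definition extensor S u : Prop :=
  (exists a : K, u = a *: 1) \/
  (exists2 vs : seq E, forall v, v \in vs -> is_vector S v
                     & u = \prod_(v <- vs) v).

(* bold s is 0 or +/- e_A, where A is the set of elements of s, so this is
   the coefficient of u on bold s, for s without repetition: see the lemmas
   plucker_alternating, pluckerK and plucker_unique. *)
Definition plucker u s : K := u [set x in s] * bold s [set x in s].

(* the element of E(KS) with Plücker coordinates f, for f alternating *)
Definition of_coords S (f : seq T -> K) : E :=
  \sum_(A : {set T} | A \subset S) f (enum A) *: bold (enum A).

(* for u a nonzero extensor, all these A have the same cardinal; rank 0 = 0 *)
Definition rank u : nat :=
  \max_(A : {set T} | plucker u (enum A) != 0) #|A|.

Definition delete1 S u x : E := of_coords (S :\ x) (plucker u).

Definition contract1 S u x : E :=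
  of_coords (S :\ x) (fun s => plucker u (rcons s x)).

(* u / X = u / x_k / ... / x_1 for X = x_1 ... x_k *)
Fixpoint contract S u X : E :=
  if X is x :: X' then contract1 (S :\: [set y in X']) (contract S u X') x
  else u.

Fixpoint delete S u X : E :=
  if X is x :: X' then delete1 (S :\: [set y in X']) (delete S u X') x
  else u.

Lemma ext_basisM A B : ext_basis A * ext_basis B =
  if [disjoint A & B] then (-1) ^+ ninv A B *: ext_basis (A :|: B) else 0.
Proof.
apply/ffunP => C; rewrite ffunE; case: ifPn => [dAB|ndAB]; last first.
  rewrite ffunE big1 // => D sDC; rewrite !ffunE.
  case: (D =P A) => [->|]; last by rewrite mul0r mulr0.
  case: (C :\: A =P B) => [eB|]; last by rewrite !mulr0.
  by case/negP: ndAB; rewrite -eB -setI_eq0 setIDA setDIl setDv set0I.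
rewrite !ffunE; case: (boolP (A \subset C)) => [sAC|nsAC]; last first.
  rewrite big1 => [|D sDC]; last first.
    rewrite !ffunE; case: (D =P A) => [eD|]; last by rewrite mul0r mulr0.
    by rewrite -eD sDC in nsAC.
  case: (C =P _) => [eC|]; last by rewrite scaler0.
  by rewrite eC subsetUl in nsAC.
rewrite (bigD1 A) //= big1 => [|D /andP[_ /negPf nDA]]; last first.
  by rewrite !ffunE nDA mul0r mulr0.
rewrite !ffunE eqxx mul1r addr0.
have -> : (C :\: A == B) = (C == A :|: B).
  apply/eqP/eqP => [<-|->]; first by rewrite -[LHS](setID _ A) (setIidPr sAC).
  by rewrite setDUl setDv set0U; apply/setDidPl; rewrite disjoint_sym.
by case: eqP => [->|_]; rewrite ?mulr0 ?scaler0 // setDUl setDv set0U;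
  rewrite (setDidPl _) // disjoint_sym.
Qed.

Lemma gen_sq x : gen x * gen x = 0.
Proof. by rewrite ext_basisM disjoints1 inE eqxx. Qed.

Lemma gen_anticomm x y : gen x * gen y = - (gen y * gen x).
Proof.
have [->|nxy] := eqVneq x y; first by rewrite gen_sq oppr0.
rewrite !ext_basisM !disjoints1 !inE [y == x]eq_sym nxy setUC -scaleNr.
congr (_ *: _); rewrite /ninv !big_set1.
case: ltngtP => [_|_|/val_inj/enum_rank_inj exy].
- by rewrite expr0 expr1 ?opprK.
- by rewrite expr0 expr1 ?opprK.
- by rewrite exy eqxx in nxy.
Qed.

Lemma vector_sq S v : is_vector S v -> v * v = 0.
Proof.
case=> c ->; set P := fun u : E => u * u = 0 /\ forall y, gen y * u = - (u * gen y).
suff [] : P (\sum_(x in S) c x *: gen x) by [].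
elim/big_rec: _ => [|x u _ [IH1 IH2]].
  by split=> [|y]; rewrite ?mulr0 // mul0r oppr0.
split=> [|y]; last first.
  by rewrite mulrDr mulrDl -scalerAr -scalerAl IH2 gen_anticomm scalerN opprD.
rewrite mulrDr !mulrDl IH1 addr0 -!scalerAl -!scalerAr gen_sq !scaler0 add0r.
by rewrite IH2 scalerN addrC addNr.
Qed.

Lemma boldE s : bold s = bold s [set x in s] *: ext_basis [set x in s].
Proof.
elim: s => [|x s IH].
  rewrite /bold big_nil; apply/ffunP => A; rewrite !ffunE set_nil eqxx.
  exact: esym (mul1r _).
have -> : bold (x :: s) = gen x * bold s by rewrite /bold big_cons.
rewrite IH -scalerAr ext_basisM set_cons; case: ifP => _.
  set B := x |: _; rewrite !scalerA; congr (_ *: _).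
  by rewrite !ffunE eqxx; exact: esym (mulr1 _).
by rewrite scaler0 ffunE scale0r.
Qed.

Lemma bold_sign s : uniq s -> bold s [set x in s] * bold s [set x in s] = 1.
Proof.
elim: s => [|x s IH] /=; first by rewrite /bold big_nil ffunE set_nil eqxx mul1r.
case/andP=> xs /IH {}IH.
have -> : bold (x :: s) = gen x * bold s by rewrite /bold big_cons.
rewrite boldE -scalerAr ext_basisM disjoints1 inE xs set_cons.
have scE (a b : K) : a *: (b : K^o) = a * b by [].
by rewrite !ffunE eqxx !scE mulr1 mulrACA IH mul1r -expr2 sqrr_sign.
Qed.

Lemma bold_rep s : ~~ uniq s -> bold s = 0.
Proof.
elim: s => //= x s IH; rewrite negb_and negbK => h.
have -> : bold (x :: s) = gen x * bold s by rewrite /bold big_cons.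
case/orP: h => [xs|/IH ->]; last by rewrite mulr0.
by rewrite boldE -scalerAr ext_basisM disjoints1 inE xs scaler0.
Qed.

End Exterior.

Definition alternating (T : eqType) (V : zmodType) (f : seq T -> V) : Prop :=
  (forall s, ~~ uniq s -> f s = 0) /\
  (forall s x y t, f (s ++ x :: y :: t) = - f (s ++ y :: x :: t)).

Lemma alternating_perm (T : eqType) (s t : seq T) : perm_eq s t ->
  exists b : bool, forall (V : zmodType) (f : seq T -> V),
    alternating f -> f s = if b then - f t else f t.
Proof.
elim: s t => [|x s IH] t.
  by rewrite perm_sym => /perm_nilP ->; exists false.
move=> pst; have /path.splitPr tE : x \in t by rewrite -(perm_mem pst) mem_head.
case: tE pst => t1 t2; rewrite perm_sym perm_catC /= perm_cons perm_catC.
rewrite perm_sym => /IH [b Hb] {IH}.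
have [c Hc] : exists c : bool, forall (V : zmodType) (f : seq T -> V),
    alternating f -> f (x :: t1 ++ t2) = if c then - f (t1 ++ x :: t2)
                                         else f (t1 ++ x :: t2).
  elim: t1 {Hb} => [|y t1 [c Hc]]; first by exists false.
  exists (~~ c) => V f altf; rewrite /= (altf.2 [::] x y).
  rewrite (Hc V (fun s => f (y :: s))); first by case: (c); rewrite /= ?opprK.
  split=> [r nr|r z1 z2 r']; last exact: (altf.2 (y :: r)).
  by apply: altf.1; rewrite /= negb_and nr orbT.
exists (b (+) c) => V f altf.
rewrite (Hb V (fun s => f (x :: s))).
  by rewrite (Hc V f altf); case: (b); case: (c); rewrite /= ?opprK.
split=> [r nr|r z1 z2 r']; last exact: (altf.2 (x :: r)).
by apply: altf.1; rewrite /= negb_and nr orbT.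
Qed.

Section Plucker.
Variables (K : comNzRingType) (T : finType).
Local Notation E := (exterior K T).
Implicit Types (A B S : {set T}) (s t : seq T) (u v : E).

Lemma bold_alternating : alternating (@bold K T).
Proof.
split=> [|s x y t]; first exact: bold_rep.
rewrite /bold !big_cat /= !big_cons (mulrA (gen K x)) gen_anticomm.
by rewrite mulNr mulrN -mulrA.
Qed.

Lemma plucker_alternating u : alternating (plucker u).
Proof.
split=> [s nus|s x y t]; rewrite /plucker.
  by rewrite bold_rep // ffunE mulr0.
have -> : [set z in s ++ x :: y :: t] = [set z in s ++ y :: x :: t].
  by apply/setP => z; rewrite !inE !mem_cat !inE; do !bool_congr.
by rewrite bold_alternating.2 ffunE mulrN.
Qed.


Lemma of_coordsE S f A : of_coords S f A =
  if A \subset S then f (enum A) * bold K (enum A) A else 0.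
Proof.
rewrite sum_ffunE; under eq_bigr => B _ do rewrite ffunE boldE set_enum !ffunE.
case: ifPn => [sAS|nsAS].
  rewrite (bigD1 A) //= eqxx big1 => [|B /andP[_ /negPf nBA]].
    by rewrite addr0; congr (_ * _); exact: mulr1.
  by rewrite eq_sym nBA !scaler0.
rewrite big1 // => B sBS; case: (A =P B) => [eAB|_]; last by rewrite !scaler0.
by rewrite eAB sBS in nsAS.
Qed.

Lemma pluckerK S u : (forall A, u A != 0 -> A \subset S) ->
  of_coords S (plucker u) = u.
Proof.
move=> suppu; apply/ffunP => A; rewrite of_coordsE; case: ifPn => [_|nsAS].
  rewrite /plucker set_enum -mulrA.
  by have := bold_sign K (enum_uniq A); rewrite set_enum => ->; rewrite mulr1.
by apply/esym/eqP; apply: contraNT nsAS; apply: suppu.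
Qed.

Lemma plucker_unique S (f : seq T -> K) s : alternating f -> {subset s <= S} ->
  plucker (of_coords S f) s = f s.
Proof.
move=> altf sS; case: (boolP (uniq s)) => [us|nus]; last first.
  by rewrite altf.1 // (plucker_alternating _).1.
have sAS : [set x in s] \subset S by apply/subsetP => x; rewrite inE => /sS.
have pse : perm_eq s (enum [set x in s]).
  by apply: uniq_perm; rewrite ?enum_uniq // => x; rewrite mem_enum inE.
have [b Hb] := alternating_perm pse.
rewrite (Hb K _ (plucker_alternating _)) (Hb K f altf).
suff -> : plucker (of_coords S f) (enum [set x in s]) = f (enum [set x in s]) by [].
rewrite /plucker set_enum of_coordsE sAS -mulrA.
by have := bold_sign K (enum_uniq [set x in s]); rewrite set_enum => ->; rewrite mulr1.
Qed.

Lemma extensor_supp S u A : extensor S u -> u A != 0 -> A \subset S.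
Proof.
set P := fun v : E => forall A, v A != 0 -> A \subset S.
suff: extensor S u -> P u by move=> h /h; apply.
have P1 : P 1.
  by move=> B; rewrite ffunE; case: (B =P set0) => [->|]; rewrite ?sub0set ?eqxx.
case=> [[a ->] B|[vs vsS ->]].
  by rewrite ffunE => h; apply: P1; apply: contraNneq h => ->; rewrite scaler0.
have PM v w : P v -> P w -> P (v * w).
  move=> Pv Pw B; rewrite ffunE => /eqP nz.
  case: (boolP (B \subset S)) => // nBS; case: nz; apply: big1 => C sCB.
  have [->|/Pv sCS] := eqVneq (v C) 0; first by rewrite mul0r mulr0.
  have [->|/Pw sBC] := eqVneq (w (B :\: C)) 0; first by rewrite !mulr0.
  by case/negP: nBS; rewrite -(setID B C) (setIidPr sCB) subUset sCS.
elim: vs vsS => [|v vs IH] vsS; first by rewrite big_nil.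
rewrite big_cons; apply: PM; last by apply: IH => w w_vs; apply: vsS; rewrite inE w_vs orbT.
have [c ->] := vsS v (mem_head _ _); move=> B; rewrite sum_ffunE => /eqP nz.
case: (boolP (B \subset S)) => // nBS; case: nz; apply: big1 => x xS.
rewrite !ffunE; case: (B =P [set x]) => [eB|_]; last by rewrite scaler0.
by rewrite eB sub1set xS in nBS.
Qed.

End Plucker.

Section Duality.
Variable T : finType.
Implicit Types (A B S : {set T}) (s t X : seq T).

Record orientation (eps : seq T -> int) : Prop := Orientation {
  orientation_alternating : alternating eps;
  orientation_values : forall s, eps s \in [:: 1; -1; 0];
  orientation_uniq : forall s, uniq s -> eps s != 0;
  orientation_nil : eps [::] = 1 }.

(* s is the set A, written in an arbitrary sequence *)
Definition lists s A : bool := uniq s && ([set x in s] == A).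

Definition dual (K : comNzRingType) (eps : seq T -> int) S
    (u : exterior K T) : exterior K T :=
  of_coords S (fun s => let sbar := enum (S :\: [set x in s]) in
                        plucker u sbar * (eps (sbar ++ s))%:~R).

End Duality.

Record matroid (T : finType) := Matroid {
  mground : {set T};
  mbases : {set {set T}};
  mbases_sub : forall B, B \in mbases -> B \subset mground;
  mbases_neq0 : mbases != set0;
  mbases_exchange : forall B1 B2 x, B1 \in mbases -> B2 \in mbases ->
    x \in B1 :\: B2 -> exists2 y, y \in B2 :\: B1 & y |: (B1 :\ x) \in mbases }.

(* Oriented matroids, given by one of their two chirotopes, chi and - chi; chi
   is defined on sequences of all lengths, and is 0 on those of length other
   than the rank. *)
Record oriented_matroid (T : finType) := OrientedMatroid {
  oground : {set T};
  orank : nat;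
  chirotope : seq T -> int;
  chirotope_values : forall s, chirotope s \in [:: 1; -1; 0];
  chirotope_supp : forall s, chirotope s != 0 ->
    size s = orank /\ {subset s <= oground};
  chirotope_neq0 : exists s, chirotope s != 0;
  chirotope_alternating : alternating chirotope;
  chirotope_exchange : forall x s t,
    chirotope (x :: s) != 0 -> chirotope t != 0 ->
    exists t1 y t2, t = t1 ++ y :: t2 /\
      chirotope (y :: s) * chirotope (t1 ++ x :: t2) =
      chirotope (x :: s) * chirotope t }.

Section DirectSum.
Variable T : finType.
Implicit Types (A B S : {set T}) (s t : seq T).

Section Matroid.
Variables (M1 M2 : matroid T).
Hypothesis dis : [disjoint mground M1 & mground M2].

Let bases := [set B1 :|: B2 | B1 in mbases M1, B2 in mbases M2].

Fact dsum_sub B : B \in bases -> B \subset mground M1 :|: mground M2.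
Proof.
by case/imset2P => B1 B2 /mbases_sub s1 /mbases_sub s2 ->; apply: setUSS.
Qed.

Fact dsum_neq0 : bases != set0.
Proof.
have /set0Pn[B1 b1] := mbases_neq0 M1; have /set0Pn[B2 b2] := mbases_neq0 M2.
by apply/set0Pn; exists (B1 :|: B2); apply/imset2P; exists B1 B2.
Qed.

Fact dsum_exchange B C x : B \in bases -> C \in bases -> x \in B :\: C ->
  exists2 y, y \in C :\: B & y |: (B :\ x) \in bases.
Proof.
have not2 z : z \in mground M1 -> z \in mground M2 -> False.
  by move=> z1 z2; move/pred0P/(_ z): dis; rewrite /= z1 z2.
case/imset2P => B1 B2 b1 b2 -> /imset2P[C1 C2 c1 c2 ->].
have [B1s B2s] := (subsetP (mbases_sub b1), subsetP (mbases_sub b2)).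
have [C1s C2s] := (subsetP (mbases_sub c1), subsetP (mbases_sub c2)).
rewrite !inE negb_or => /andP[/andP[nx1 nx2] /orP[xB|xB]].
  have [|y] := mbases_exchange b1 c1 (x := x); first by rewrite inE nx1.
  rewrite inE => /andP[nyB yC] bN; exists y.
    rewrite !inE yC (negPf nyB) andbT /=.
    by apply/negP => /B2s; apply: not2; apply: C1s.
  apply/imset2P; exists (y |: B1 :\ x) B2 => //.
  rewrite -setUA; congr (_ :|: _); rewrite setDUl; congr (_ :|: _).
  apply/setDidPl; rewrite disjoint_sym disjoints1.
  by apply/negP => /B2s; apply: not2; apply: B1s.
have [|y] := mbases_exchange b2 c2 (x := x); first by rewrite inE nx2.
rewrite inE => /andP[nyB yC] bN; exists y.
  rewrite !inE yC (negPf nyB) orbF orbT andbT.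
  by apply/negP => /B1s y1; apply: (not2 y) => //; apply: C2s.
apply/imset2P; exists B1 (y |: B2 :\ x) => //.
rewrite setUCA; congr (_ :|: _); rewrite setDUl; congr (_ :|: _).
apply/setDidPl; rewrite disjoint_sym disjoints1.
by apply/negP => /B1s x1; apply: (not2 x) => //; apply: B2s.
Qed.

Definition mdsum : matroid T := Matroid dsum_sub dsum_neq0 dsum_exchange.

End Matroid.

(* the number of pairs of an element out of A followed by one in A *)
Fixpoint nshuffle A s : nat :=
  if s is x :: s' then
    ((x \notin A) * count (mem A) s' + nshuffle A s')%N
  else 0%N.

(* the alternating extension of chi (s1 ++ s2) = chi1 s1 * chi2 s2, for s1 in A
   and s2 out of A *)
Definition chi_dsum A (chi1 chi2 : seq T -> int) s : int :=
  (-1) ^+ nshuffle A s * (chi1 [seq x <- s | x \in A]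
                          * chi2 [seq x <- s | x \notin A]).

Lemma nshuffle_cat A s t : nshuffle A (s ++ t) =
  (nshuffle A s + nshuffle A t + count (predC (mem A)) s * count (mem A) t)%N.
Proof.
elim: s => [|x s IH] /=; first by rewrite addn0.
by rewrite IH count_cat; case: (x \in A); lia.
Qed.

Lemma nshuffle_subst A s x y t : (x \in A) = (y \in A) ->
  nshuffle A (s ++ x :: t) = nshuffle A (s ++ y :: t).
Proof. by move=> exy; rewrite !nshuffle_cat /= exy. Qed.

Lemma uniq_filter2 (a : pred T) s :
  uniq s = uniq (filter a s) && uniq (filter (predC a) s).
Proof.
rewrite -(perm_uniq (permEl (perm_filterC a s))) cat_uniq; congr (_ && _).
suff -> : has (mem (filter a s)) (filter (predC a) s) = false by [].
apply/negP => /hasP[x]; rewrite mem_filter /= => /andP[nax _].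
by rewrite mem_filter (negPf nax).
Qed.

Lemma filter_split (a : pred T) s t1 y t2 : filter a s = t1 ++ y :: t2 ->
  exists s1 s2, [/\ s = s1 ++ y :: s2, filter a s1 = t1 & filter a s2 = t2].
Proof.
elim: s t1 => [|x s IH] t1 /=; first by case: t1.
case: ifP => ax; last first.
  move=> /IH[s1 [s2 [-> <- <-]]]; exists (x :: s1), s2.
  by split=> //=; rewrite ax.
case: t1 => [[-> <-]|z t1 [<- /IH[s1 [s2 [-> <- <-]]]]].
  by exists [::], s.
by exists (x :: s1), s2; split=> //=; rewrite ax.
Qed.

Section Oriented.
Variables (M1 M2 : oriented_matroid T).
Hypothesis dis : [disjoint oground M1 & oground M2].

Let chi := chi_dsum (oground M1) (chirotope M1) (chirotope M2).

Fact dsum_values s : chi s \in [:: 1; -1; 0].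
Proof.
rewrite /chi /chi_dsum -signr_odd.
set u := chirotope M1 _; set v := chirotope M2 _.
have : u \in [:: 1; -1; 0] by apply: chirotope_values.
have : v \in [:: 1; -1; 0] by apply: chirotope_values.
by rewrite !inE => /or3P[] /eqP-> /or3P[] /eqP->; case: odd.
Qed.

Fact chi_neq0 s : (chi s != 0) =
  (chirotope M1 [seq x <- s | x \in oground M1] != 0) &&
  (chirotope M2 [seq x <- s | x \notin oground M1] != 0).
Proof. by rewrite /chi /chi_dsum mulf_eq0 signr_eq0 /= mulf_eq0 negb_or. Qed.

Fact dsum_supp s : chi s != 0 ->
  size s = (orank M1 + orank M2)%N /\ {subset s <= oground M1 :|: oground M2}.
Proof.
rewrite chi_neq0 => /andP[/chirotope_supp[<- s1] /chirotope_supp[<- s2]].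
split=> [|x xs]; first by rewrite !size_filter count_predC.
rewrite inE; case: (boolP (x \in oground M1)) => //= nx1.
by apply: s2; rewrite mem_filter nx1.
Qed.

Fact odsum_neq0 : exists s, chi s != 0.
Proof.
have [s1 n1] := chirotope_neq0 M1; have [s2 n2] := chirotope_neq0 M2.
have [_ sub1] := chirotope_supp n1; have [_ sub2] := chirotope_supp n2.
have e1 : all (mem (oground M1)) s1 by apply/allP.
have e2 : all (predC (mem (oground M1))) s2.
  apply/allP => x /sub2 x2; apply/negP => /= x1.
  by move/pred0P/(_ x): dis; rewrite /= x1 x2.
exists (s1 ++ s2); rewrite chi_neq0 !filter_cat.
have -> : [seq x <- s1 | x \in oground M1] = s1 by apply/all_filterP.
have -> : [seq x <- s2 | x \notin oground M1] = s2 by apply/all_filterP.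
have -> : [seq x <- s2 | x \in oground M1] = [::].
  by apply/eqP; rewrite -[_ == _]negbK -has_filter -all_predC.
have -> : [seq x <- s1 | x \notin oground M1] = [::].
  apply/eqP; rewrite -[_ == _]negbK -has_filter -all_predC.
  by apply/allP => x /(allP e1) /= ->.
by rewrite cats0 n1.
Qed.

Fact dsum_alternating : alternating chi.
Proof.
have [alt1 alt2] := (chirotope_alternating M1, chirotope_alternating M2).
split=> [s|s x y t].
  rewrite (uniq_filter2 (mem (oground M1))) negb_and /chi /chi_dsum.
  case/orP => [/alt1.1 e|/alt2.1 e]; first by rewrite [chirotope M1 _]e mul0r mulr0.
  by rewrite [chirotope M2 _]e !mulr0.
rewrite /chi /chi_dsum !filter_cat /=.
case: (boolP (x \in oground M1)) => x1; case: (boolP (y \in oground M1)) => y1 /=.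
- rewrite alt1.2 mulNr mulrN; congr (- ((-1) ^+ _ * _)).
  by rewrite !nshuffle_cat /= x1 y1; lia.
- rewrite -mulNr; congr (_ * _); rewrite -[in LHS]signr_odd -[in RHS]signr_odd.
  by rewrite -signrN; congr (_ ^+ _); rewrite !nshuffle_cat /= x1 (negPf y1); lia.
- rewrite -mulNr; congr (_ * _); rewrite -[in LHS]signr_odd -[in RHS]signr_odd.
  by rewrite -signrN; congr (_ ^+ _); rewrite !nshuffle_cat /= y1 (negPf x1); lia.
- rewrite alt2.2 !mulrN; congr (- ((-1) ^+ _ * _)).
  by rewrite !nshuffle_cat /= (negPf x1) (negPf y1); lia.
Qed.

Fact dsum_chi_exchange x s t : chi (x :: s) != 0 -> chi t != 0 ->
  exists t1 y t2, t = t1 ++ y :: t2 /\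
    chi (y :: s) * chi (t1 ++ x :: t2) = chi (x :: s) * chi t.
Proof.
rewrite !chi_neq0 /=.
case: (boolP (x \in oground M1)) => x1 /= /andP[n1 n2] /andP[m1 m2].
  have [u1 [y [u2 [et E]]]] := chirotope_exchange n1 m1.
  have y1 : y \in oground M1.
    have : y \in [seq z <- t | z \in oground M1].
      by rewrite et mem_cat mem_head orbT.
    by rewrite mem_filter => /andP[].
  have [t1 [t2 [tE e1 e2]]] := filter_split et.
  exists t1, y, t2; split=> //; rewrite tE /chi /chi_dsum.
  rewrite (@nshuffle_subst _ [::] y x) ?y1 ?x1 //.
  rewrite (@nshuffle_subst _ t1 x y) ?y1 ?x1 //.
  rewrite !filter_cat /= x1 y1 /= e1 e2 mulrACA [RHS]mulrACA; congr (_ * _).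
  by rewrite mulrACA [RHS]mulrACA; congr (_ * _); rewrite E -et tE.
have [u1 [y [u2 [et E]]]] := chirotope_exchange n2 m2.
have y1 : y \notin oground M1.
  have : y \in [seq z <- t | z \notin oground M1].
    by rewrite et mem_cat mem_head orbT.
  by rewrite mem_filter => /andP[].
have [t1 [t2 [tE e1 e2]]] := filter_split et.
exists t1, y, t2; split=> //; rewrite tE /chi /chi_dsum.
rewrite (@nshuffle_subst _ [::] y x) ?(negPf y1) ?(negPf x1) //.
rewrite (@nshuffle_subst _ t1 x y) ?(negPf y1) ?(negPf x1) //.
rewrite !filter_cat /= (negPf x1) (negPf y1) /= e1 e2.
rewrite mulrACA [RHS]mulrACA; congr (_ * _).
by rewrite mulrACA [RHS]mulrACA; congr (_ * _); rewrite E et.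
Qed.

Definition odsum : oriented_matroid T :=
  OrientedMatroid dsum_values dsum_supp odsum_neq0 dsum_alternating
    dsum_chi_exchange.

End Oriented.
End DirectSum.

(* u presents a matroid on S only if u != 0, since mbases M is not empty *)
Definition presents (K : comNzRingType) (T : finType) S (u : exterior K T)
    (M : matroid T) : Prop :=
  mground M = S /\
  mbases M = [set B : {set T} | plucker u (enum B) != 0].

Definition opresents (K : realFieldType) (T : finType) S (u : exterior K T)
    (M : oriented_matroid T) : Prop :=
  oground M = S /\
  exists b : bool, forall s, sgz (plucker u s) = (-1) ^+ b * chirotope M s.

(* Main.v *)
(* Everything is checked on Plücker coordinates, where all the formulas are
   identities between signs of sequences: two alternating functions agree on all
   the orderings of a set as soon as they agree on one of them, the product of
   two alternating functions does not depend on the ordering, and exchanging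
   two blocks of lengths p and q costs (-1)^(pq). An extensor only enters
   through its support in S and through its homogeneity, which turns the block
   lengths into ranks. *)

Require Import Defs.
From mathcomp Require Import all_boot all_order all_algebra.
From mathcomp Require Import ring.

Set Implicit Arguments.
Unset Strict Implicit.
Unset Printing Implicit Defensive.

Import Order.TTheory GRing.Theory Num.Theory.
Local Open Scope ring_scope.

(** * Alternating functions: permutations, fixed blocks and block exchange *)

Section Alternating.
Variables (T : eqType) (R : pzRingType).
Implicit Types (s t r : seq T).

(** Both functions pick up the same sign, which squares to 1. *)
Lemma alternating_perm_mul (f g : seq T -> R) s t :
  alternating f -> alternating g -> perm_eq s t -> f s * g s = f t * g t.
Proof.
move=> altf altg /alternating_perm[b Hb]; rewrite !Hb //.
by case: (b); rewrite ?mulrNN.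
Qed.

Lemma alternating_eq (V : zmodType) (f g : seq T -> V) s t :
  alternating f -> alternating g -> perm_eq s t -> f t = g t -> f s = g s.
Proof. by move=> altf altg /alternating_perm[b Hb] e; rewrite !Hb // e. Qed.

(** Fixing one end of the sequence lets permutation arguments act on a block inside a longer
    sequence. *)
Lemma alternating_catr (V : zmodType) (f : seq T -> V) r :
  alternating f -> alternating (fun s => f (s ++ r)).
Proof.
move=> altf; split=> [s nus|s x y t]; last by rewrite -!catA altf.2.
by apply: altf.1; rewrite cat_uniq (negPf nus).
Qed.

Lemma alternating_catl (V : zmodType) (f : seq T -> V) r :
  alternating f -> alternating (fun s => f (r ++ s)).
Proof.
move=> altf; split=> [s nus|s x y t]; last by rewrite !catA altf.2.
by apply: altf.1; rewrite cat_uniq (negPf nus) !andbF.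
Qed.

Lemma alternating_swap (f : seq T -> R) s t :
  alternating f -> f (s ++ t) = (-1) ^+ (size s * size t) * f (t ++ s).
Proof.
elim: s t f => [|x s IH] t f altf; first by rewrite mul0n mul1r cats0.
(* One sign per element of [t']; quantifying over [g] lets the induction absorb each passed element
   into the function. *)
have move1 t' r g : alternating g ->
    g (x :: t' ++ r) = (-1) ^+ size t' * g (t' ++ x :: r) :> R.
  elim: t' g => [|y t' IHt] g altg; first by rewrite mul1r.
  rewrite /= (altg.2 [::] x y) /= (IHt (fun s => g (y :: s))).
    by rewrite exprS !mulN1r mulNr.
  exact: (alternating_catl [:: y]).
rewrite /= (IH t (fun s => f (x :: s))); last exact: (alternating_catl [:: x]).
by rewrite move1 // mulrA -exprD mulSn addnC.
Qed.

End Alternating.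

(** * Supports, degrees, and Plücker coordinates of products and minors *)

Section Coordinates.
Variables (K : comNzRingType) (T : finType).
Local Notation E := (exterior K T).
Implicit Types (A B S : {set T}) (s t X Y : seq T) (u v : E).

Definition supported S u : Prop := forall A, u A != 0 -> A \subset S.

(** Zero is homogeneous of every degree, so the lemmas below take the degree [k] as a parameter; it
    is forced to be [rank u] when [u != 0]. *)
Definition homogeneous k u : Prop := forall A, u A != 0 -> #|A| = k.

(** The coordinate of [bold] at its own set squares to 1, hence can be cancelled. *)
Lemma plucker_enum_eq0 u A : (plucker u (enum A) == 0) = (u A == 0).
Proof.
have := bold_sign K (enum_uniq A); rewrite /plucker set_enum => b2.
apply/eqP/eqP => [e0|->]; last by rewrite mul0r.
by rewrite -[u A]mulr1 -b2 mulrA e0 mul0r.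
Qed.

Lemma plucker_neq0 u s : plucker u s != 0 ->
  uniq s /\ u [set x in s] != 0.
Proof.
move=> nz; split.
  by apply: contraNT nz => /(plucker_alternating u).1 ->.
by apply: contraNneq nz => u0; rewrite /plucker u0 mul0r.
Qed.

Lemma plucker_homogeneous k u s : homogeneous k u -> plucker u s != 0 ->
  size s = k.
Proof.
move=> hu /plucker_neq0[us /hu <-].
by rewrite cardsE (card_uniqP us).
Qed.

Lemma plucker_ext S u v : supported S u -> supported S v ->
  (forall s, uniq s -> {subset s <= S} -> plucker u s = plucker v s) -> u = v.
Proof.
move=> suppu suppv e; rewrite -(pluckerK suppu) -(pluckerK suppv).
apply: eq_bigr => A sAS; rewrite e ?enum_uniq // => x.
by rewrite mem_enum => /(subsetP sAS).
Qed.

Lemma supported_of_coords S (f : seq T -> K) : supported S (of_coords S f).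
Proof. by move=> A; rewrite of_coordsE; case: ifP => // _; rewrite eqxx. Qed.

Lemma supportedZ S a u : supported S u -> supported S (a *: u).
Proof.
move=> suppu A; rewrite ffunE => nz; apply: suppu.
by apply: contraNneq nz => ->; rewrite scaler0.
Qed.

Lemma ext_mul_neq0 u v A : (u * v) A != 0 ->
  exists B, [/\ B \subset A, u B != 0 & v (A :\: B) != 0].
Proof.
rewrite ffunE => nz.
case: (pickP (fun B => [&& B \subset A, u B != 0 & v (A :\: B) != 0])).
  by move=> B /and3P[]; exists B.
move=> none; case/eqP: nz; apply: big1 => B sBA.
have := none B; rewrite sBA /=; have [->|/= _ /negbFE/eqP ->] := eqVneq (u B) 0.
  by rewrite mul0r mulr0.
by rewrite !mulr0.
Qed.

Lemma supportedM S1 S2 u v : supported S1 u -> supported S2 v ->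
  supported (S1 :|: S2) (u * v).
Proof.
move=> su sv A /ext_mul_neq0[B [sBA /su sB /sv sAB]].
by rewrite -(setID A B) (setIidPr sBA) setUSS.
Qed.

Lemma homogeneousM k l u v : homogeneous k u -> homogeneous l v ->
  homogeneous (k + l) (u * v).
Proof.
move=> hu hv A /ext_mul_neq0[B [sBA /hu <- /hv <-]].
by rewrite -(cardsID B A) (setIidPr sBA).
Qed.

Lemma homogeneous1 : homogeneous 0 (1 : E).
Proof. by move=> A; rewrite ffunE; case: (A =P set0) => [->|]; rewrite ?cards0 ?eqxx. Qed.

Lemma homogeneous_vector S v : is_vector S v -> homogeneous 1 v.
Proof.
case=> c -> A; rewrite sum_ffunE.
have [/cards1P[x ->]|n1] := boolP (#|A| == 1%N); first by rewrite cards1.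
rewrite big1 ?eqxx // => x _; rewrite !ffunE.
by case: (A =P [set x]) => [eA|_]; [rewrite eA cards1 in n1 | rewrite scaler0].
Qed.

Lemma extensor_homogeneous S u : extensor S u -> exists k, homogeneous k u.
Proof.
case=> [[a ->]|[vs vsS ->]].
  exists 0%N => A; rewrite ffunE => nz; apply: homogeneous1.
  by apply: contraNneq nz => ->; rewrite scaler0.
elim: vs vsS => [|v vs IH] vsS.
  by rewrite big_nil; exists 0%N; apply: homogeneous1.
have [|k hk] := IH; first by move=> w wvs; apply: vsS; rewrite inE wvs orbT.
rewrite big_cons; exists (1 + k)%N; apply: homogeneousM => //.
by apply: (@homogeneous_vector S); apply: vsS; apply: mem_head.
Qed.

Lemma rank_homogeneous k u : homogeneous k u -> u != 0 -> rank u = k.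
Proof.
move=> hu nz; have [A nA] : exists A, u A != 0.
  case: (pickP (fun A => u A != 0)) => [A nA|none]; first by exists A.
  case/eqP: nz; apply/ffunP => A; rewrite [RHS]ffunE.
  exact/eqP/negbFE/none.
apply/eqP; rewrite eqn_leq; apply/andP; split.
  by apply/bigmax_leqP => B; rewrite plucker_enum_eq0 => /hu ->.
rewrite -(hu A nA); apply: (@leq_bigmax_cond _ _ (fun A => #|A|)).
by rewrite plucker_enum_eq0.
Qed.

Lemma plucker0 s : plucker (0 : E) s = 0.
Proof. by rewrite /plucker ffunE mul0r. Qed.

Lemma pluckerD u v s : plucker (u + v) s = plucker u s + plucker v s.
Proof. by rewrite /plucker ffunE mulrDl. Qed.

Lemma pluckerZ a u s : plucker (a *: u) s = a * plucker u s.
Proof. by rewrite /plucker ffunE mulrA. Qed.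

Lemma plucker_size k u s : homogeneous k u -> plucker u s != 0 ->
  size s = rank u.
Proof.
move=> hk nz; rewrite (rank_homogeneous hk); first exact: plucker_homogeneous nz.
by apply: contraNneq nz => ->; rewrite plucker0.
Qed.

(** Only the splitting with [C = A] contributes to the product: [u C != 0] forces [C] into [S1],
    hence away from [B], and an element of [A] left out of [C] would have to lie in [S2]. *)
Lemma ext_mulU S1 S2 u v A B :
  [disjoint S1 & S2] -> supported S1 u -> supported S2 v ->
  A \subset S1 -> [disjoint B & S1] ->
  (u * v) (A :|: B) = (-1) ^+ ninv A B * (u A * v B).
Proof.
move=> dS su sv sA dB; have dBA : [disjoint B & A] by apply: disjointWr sA dB.
rewrite ffunE (bigD1 A) ?subsetUl //= [X in _ + X]big1 ?addr0 => [|C].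
  by rewrite setDUl setDv set0U (setDidPl _).
case/andP=> sC nCA; have [->|/su sC1] := eqVneq (u C) 0.
  by rewrite mul0r mulr0.
have [->|/sv sC2] := eqVneq (v ((A :|: B) :\: C)) 0; first by rewrite !mulr0.
case/eqP: nCA; apply/eqP; rewrite eqEsubset; apply/andP; split.
  apply/subsetP => x xC; have := subsetP sC x xC; rewrite inE => /orP[//|xB].
  by move/pred0P/(_ x): dB; rewrite /= xB (subsetP sC1).
apply/subsetP => x xA; apply: contraT => nxC.
have x2 : x \in S2 by apply: (subsetP sC2); rewrite in_setD nxC in_setU xA.
by move/pred0P/(_ x): dS; rewrite /= x2 (subsetP sA).
Qed.

(* The signs of e_A e_B and of bold (s1 ++ s2) cancel out. *)
Lemma pluckerM S1 S2 u v s1 s2 :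
  [disjoint S1 & S2] -> supported S1 u -> supported S2 v ->
  {subset s1 <= S1} -> (forall x, x \in s2 -> x \notin S1) ->
  plucker (u * v) (s1 ++ s2) = plucker u s1 * plucker v s2.
Proof.
move=> dS su sv s1S s2S; rewrite /plucker.
have -> : [set x in s1 ++ s2] = [set x in s1] :|: [set x in s2].
  by apply/setP => x; rewrite !inE mem_cat.
set A := [set x in s1]; set B := [set x in s2].
have sA : A \subset S1 by apply/subsetP => x; rewrite inE => /s1S.
have dB : [disjoint B & S1].
  rewrite -setI_eq0; apply/eqP/setP => x; rewrite !inE.
  by apply/negP => /andP[/s2S/negP].
rewrite (ext_mulU dS su sv sA dB).
have dAB : [disjoint A & B] by rewrite disjoint_sym; apply: disjointWr sA dB.
have -> : bold K (s1 ++ s2) (A :|: B) =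
    (-1) ^+ ninv A B * (bold K s1 A * bold K s2 B).
  have -> : bold K (s1 ++ s2) = bold K s1 * bold K s2.
    by rewrite /bold big_cat.
  rewrite [in LHS](boldE K s1) [in LHS](boldE K s2) -/A -/B.
  rewrite -scalerAl -scalerAr ext_basisM dAB !ffunE eqxx.
  by rewrite [LHS]mulrA [RHS]mulrC; congr (_ * _); exact: mulr1.
by rewrite mulrACA -expr2 sqrr_sign mul1r mulrACA.
Qed.

(** For empty [X] the support is that of [u] itself; any actual deletion goes through [of_coords],
    which truncates to the smaller ground set. *)
Lemma supported_delete S u X : supported S u ->
  supported (S :\: [set x in X]) (delete S u X).
Proof.
move=> su; case: X => [|x X]; first by rewrite set_nil setD0.
by rewrite set_cons setUC -setDDl; apply: supported_of_coords.
Qed.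

Lemma supported_contract S u X : supported S u ->
  supported (S :\: [set x in X]) (contract S u X).
Proof.
move=> su; case: X => [|x X]; first by rewrite set_nil setD0.
by rewrite set_cons setUC -setDDl; apply: supported_of_coords.
Qed.

Lemma plucker_delete S u X s : {subset s <= S :\: [set x in X]} ->
  plucker (delete S u X) s = plucker u s.
Proof.
elim: X => //= x X IH; rewrite set_cons setUC -setDDl => sS.
rewrite plucker_unique //; last exact: plucker_alternating.
by rewrite IH // => y /sS; rewrite inE => /andP[].
Qed.

(** Settles the zero extensor in the contraction formula, where the convention [rank 0 = 0] says
    nothing about degrees. *)
Lemma delete0 S X : delete S (0 : E) X = 0.
Proof.
apply: (plucker_ext (S := S :\: [set x in X])) => [||s us sS].
- by apply: supported_delete => A; rewrite ffunE eqxx.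
- by move=> A; rewrite ffunE eqxx.
by rewrite plucker_delete.
Qed.

(** Contracting by [x :: X] contracts [X] first and [x] afterwards, so [x] is inserted between [s]
    and [X]. *)
Lemma plucker_contract S u X s : uniq X -> {subset X <= S} ->
  {subset s <= S :\: [set x in X]} ->
  plucker (contract S u X) s = plucker u (s ++ X).
Proof.
elim: X s => [|x X IH] s /=; first by rewrite cats0.
case/andP=> xX uX XS; rewrite set_cons setUC -setDDl => sS.
(* Appending [x] keeps the coordinates alternating in the remaining sequence. *)
rewrite plucker_unique //; last first.
  have := alternating_catr [:: x] (plucker_alternating (contract S u X)).
  by case=> a1 a2; split=> [t /a1|t y z t']; rewrite ?cats1 // -!cats1 a2.
rewrite IH ?cat_rcons // => y; first by move=> yX; apply: XS; rewrite inE yX orbT.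
rewrite mem_rcons inE => /predU1P[->|/sS]; last by rewrite inE => /andP[].
by rewrite !inE xX XS ?mem_head.
Qed.

End Coordinates.

(** * Closure properties of extensors *)

Section Products.
Variables (K : comNzRingType) (T : finType).
Local Notation E := (exterior K T).
Implicit Types (A B S : {set T}) (u v : E).

Lemma is_vectorS S S' v : S \subset S' -> is_vector S v -> is_vector S' v.
Proof.
move=> sS [c ->]; exists (fun x => if x \in S then c x else 0).
rewrite [RHS](bigID (mem S)) /= [X in _ + X]big1 ?addr0 => [|x /andP[_ /negPf->]].
  apply: eq_big => [x|x ->//].
  by apply/idP/andP => [xS|[]//]; rewrite (subsetP sS).
by rewrite scale0r.
Qed.

Lemma is_vectorZ S a v : is_vector S v -> is_vector S (a *: v).
Proof.
case=> c ->; exists (fun x => a * c x); rewrite scaler_sumr.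
by apply: eq_bigr => x _; rewrite scalerA.
Qed.

Lemma extensorS S S' u : S \subset S' -> extensor S u -> extensor S' u.
Proof.
move=> sS [h|[vs vsS ->]]; [by left|right; exists vs => // v /vsS].
exact: is_vectorS.
Qed.

(** The scalar is absorbed by the first factor; the empty product has none and becomes a multiple of
    1. *)
Lemma extensorZ S a u : extensor S u -> extensor S (a *: u).
Proof.
case=> [[b ->]|[[|v vs] vsS ->]].
- by left; exists (a * b); rewrite scalerA.
- by left; exists a; rewrite big_nil.
right; exists (a *: v :: vs); last by rewrite !big_cons scalerAl.
move=> w; rewrite inE => /predU1P[->|wvs]; last by apply: vsS; rewrite inE wvs orbT.
by apply: is_vectorZ; apply: vsS; apply: mem_head.
Qed.

Lemma extensorM S u v : extensor S u -> extensor S v -> extensor S (u * v).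
Proof.
case=> [[a ->]|[vs vsS ->]] extv.
  by rewrite -scalerAl mul1r; apply: extensorZ.
case: extv => [[a ->]|[ws wsS ->]].
  by rewrite -scalerAr mulr1; apply: extensorZ; right; exists vs.
right; exists (vs ++ ws); last by rewrite big_cat.
by move=> w; rewrite mem_cat => /orP[/vsS|/wsS].
Qed.

End Products.

(** * Ground set orientations and the canonical dual *)

Section Duals.
Variables (K : comNzRingType) (T : finType) (eps : seq T -> int).
Hypothesis Heps : orientation eps.
Local Notation E := (exterior K T).
Local Notation e s := ((eps s)%:~R : K).
Implicit Types (A B S : {set T}) (s t r X Y : seq T) (u v : E).

Lemma listsP s A : lists s A -> uniq s /\ s =i A.
Proof. by case/andP=> us /eqP <-; split=> // x; rewrite inE. Qed.

Lemma lists_intro s A : uniq s -> s =i A -> lists s A.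
Proof.
by move=> us sA; rewrite /lists us; apply/eqP/setP => x; rewrite inE sA.
Qed.

Lemma lists_size s A : lists s A -> size s = #|A|.
Proof. by case/andP=> us /eqP <-; rewrite cardsE (card_uniqP us). Qed.

Lemma lists_perm s t A : lists s A -> lists t A -> perm_eq s t.
Proof.
move=> /listsP[us sA] /listsP[ut tA]; apply: uniq_perm => // x.
by rewrite sA tA.
Qed.

Lemma lists_enum A : lists (enum A) A.
Proof. by apply: lists_intro => [|x]; rewrite ?enum_uniq ?mem_enum. Qed.

Lemma lists_cat s t A : lists t (A :\: [set x in s]) ->
  uniq s -> {subset s <= A} -> lists (t ++ s) A.
Proof.
move=> /listsP[ut tA] us sA; apply: lists_intro => [|x].
  rewrite cat_uniq ut us andbT /=; apply/hasPn => x xs.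
  by rewrite /= tA !inE xs.
rewrite mem_cat tA !inE; case: (boolP (x \in s)) => [/sA ->|]; last by rewrite orbF.
by rewrite orbT.
Qed.

Lemma sign_alternating : alternating (fun s => e s).
Proof.
have [alt1 alt2] := orientation_alternating Heps.
by split=> [s /alt1 ->//|s x y t]; rewrite alt2 rmorphN.
Qed.

Lemma sign_sq s : uniq s -> e s * e s = 1.
Proof.
move=> us; rewrite -intrM.
have := orientation_values Heps s; have := orientation_uniq Heps us.
by rewrite !inE => nz /or3P[] /eqP es; rewrite es ?eqxx in nz *.
Qed.

(** The product [e s * e (s ++ r)] does not depend on the order of [s], and [e s] is its own
    inverse. *)
Lemma sign_perm_catr s t r : uniq s -> perm_eq s t ->
  e (s ++ r) = e s * e t * e (t ++ r).
Proof.
move=> us pst; rewrite -mulrA.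
have alt := alternating_catr r sign_alternating.
have /= <- := alternating_perm_mul sign_alternating alt pst.
by rewrite mulrA sign_sq // mul1r.
Qed.

Lemma sign_perm_catl s t r : uniq s -> perm_eq s t ->
  e (r ++ s) = e s * e t * e (r ++ t).
Proof.
move=> us pst; rewrite -mulrA.
have alt := alternating_catl r sign_alternating.
have /= <- := alternating_perm_mul sign_alternating alt pst.
by rewrite mulrA sign_sq // mul1r.
Qed.

Lemma plucker_dual S u s t : {subset s <= S} -> lists t (S :\: [set x in s]) ->
  plucker (dual eps S u) s = plucker u t * e (t ++ s).
Proof.
move=> sS tS; rewrite plucker_unique //.
  have alt := alternating_catr s sign_alternating.
  apply: (alternating_perm_mul (plucker_alternating u) alt).
  exact: lists_perm (lists_enum _) tS.
(* The function defining [dual] is alternating: a transposition leaves the set of elements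
   unchanged, hence also the chosen complement, and only [eps] changes sign. *)
split=> [s' nus|s' x y t'] /=.
  by rewrite sign_alternating.1 ?mulr0 // cat_uniq (negPf nus) !andbF.
have -> : [set z in s' ++ x :: y :: t'] = [set z in s' ++ y :: x :: t'].
  by apply/setP => z; rewrite !inE !mem_cat !inE; do !bool_congr.
by rewrite [in LHS]catA sign_alternating.2 -catA mulrN.
Qed.

Lemma supported_dual S u : supported S (dual eps S u).
Proof. exact: supported_of_coords. Qed.

Lemma dualD S u v : dual eps S (u + v) = dual eps S u + dual eps S v.
Proof.
rewrite /dual /of_coords -big_split; apply: eq_bigr => A _.
by rewrite pluckerD mulrDl scalerDl.
Qed.

Lemma dualZ S a u : dual eps S (a *: u) = a *: dual eps S u.
Proof.
rewrite /dual /of_coords scaler_sumr; apply: eq_bigr => A _.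
by rewrite pluckerZ scalerA -mulrA.
Qed.

Lemma dual0 S : dual eps S (0 : E) = 0.
Proof. by rewrite -[in LHS](scale0r (0 : E)) dualZ scale0r. Qed.

(** A nonzero coordinate of the dual at [A] comes from a nonzero coordinate of [u] at the complement
    of [A] in [S]. *)
Lemma dual_homogeneous S k u : supported S u -> homogeneous k u ->
  homogeneous (#|S| - k) (dual eps S u).
Proof.
move=> su hu A nA; have sA := @supported_dual S u A nA.
have sub : {subset enum A <= S} by move=> x; rewrite mem_enum => /(subsetP sA).
have := nA; rewrite -plucker_enum_eq0 (plucker_dual _ sub (lists_enum _)).
rewrite set_enum => nz.
have /(plucker_homogeneous hu) <- : plucker u (enum (S :\: A)) != 0.
  by apply: contraNneq nz => ->; rewrite mul0r.
by rewrite -cardE -{1}(cardsID A S) (setIidPr sA) addnK.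
Qed.

(** Since [s] lists the complement of its own complement [t], dualizing twice evaluates [u] at [s]
    again; what remains is the sign of exchanging the blocks [s] and [t]. *)
Lemma dualK S k u : supported S u -> homogeneous k u ->
  dual eps S (dual eps S u) = (-1) ^+ (k * (#|S| - k)) *: u.
Proof.
move=> su hu; apply: (plucker_ext (S := S)).
- exact: supported_dual.
- exact: supportedZ.
move=> s us sS; set t := enum (S :\: [set x in s]).
have tS : lists t (S :\: [set x in s]) by apply: lists_enum.
have [ut tE] := listsP tS.
have tsub : {subset t <= S} by move=> x; rewrite tE inE => /andP[].
have stS : lists s (S :\: [set x in t]).
  apply: lists_intro => // x; rewrite in_setD inE tE !inE negb_and negbK.
  by case: (boolP (x \in s)) => [/sS ->|]; rewrite //= andNb.
rewrite (plucker_dual _ sS tS) (plucker_dual _ tsub stS) pluckerZ.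
(* A zero coordinate makes both sides vanish; a nonzero one gives [s] and [t] the lengths [k] and
   [#|S| - k]. *)
have [->|nz] := eqVneq (plucker u s) 0; first by rewrite mulr0 !mul0r.
rewrite (alternating_swap s t sign_alternating) (plucker_homogeneous hu nz).
have -> : size t = (#|S| - k)%N.
  have := lists_size (lists_cat tS us sS).
  by rewrite size_cat (plucker_homogeneous hu nz) => <-; rewrite addnK.
have [uts _] := listsP (lists_cat tS us sS).
by move: (plucker u s) => p; rewrite -!mulrA sign_sq // mulr1 mulrC.
Qed.

(** By the double dual formula the dual of a nonzero element is nonzero, so its rank is its
    degree. *)
Lemma rank_dual S k u : supported S u -> homogeneous k u -> u != 0 ->
  rank (dual eps S u) = (#|S| - k)%N.
Proof.
move=> su hu nz; apply: rank_homogeneous; first exact: dual_homogeneous.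
apply: contraNneq nz => d0.
have := dualK su hu; rewrite d0 dual0 => /(congr1 (fun v => (-1) ^+ (k * (#|S| - k)) *: v)).
by rewrite scaler0 scalerA -expr2 sqrr_sign scale1r => <-.
Qed.

(** * Duals of deletions and contractions *)

Section Minors.
Variables (S : {set T}) (u : E) (X S' : seq T).
Hypotheses (su : supported S u) (uX : uniq X) (XS : {subset X <= S}).
Hypothesis S'E : lists S' (S :\: [set x in X]).

(** One sequence [t] serves both duals: it is the complement of [s] in the minor, and in [S] the
    block [X] can be put with [s] or with [t]. *)
Lemma lists_minor s t : uniq s -> {subset s <= S :\: [set x in X]} ->
  lists t (S :\: [set x in X] :\: [set x in s]) ->
  [/\ {subset s <= S}, {subset s ++ X <= S},
      lists t (S :\: [set x in s ++ X]) &
      lists (t ++ X) (S :\: [set x in s])].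
Proof.
move=> us sS tE; have sS0 : {subset s <= S} by move=> x /sS; rewrite inE => /andP[].
split=> //.
- by move=> x; rewrite mem_cat => /orP[/sS0|/XS].
- suff -> : S :\: [set x in s ++ X] = S :\: [set x in X] :\: [set x in s] by [].
  by apply/setP => x; rewrite !inE mem_cat negb_or andbA.
apply: lists_cat => // [|x xX].
  suff -> : S :\: [set x in s] :\: [set x in X] =
            S :\: [set x in X] :\: [set x in s] by [].
  by rewrite !setDDl setUC.
by rewrite !inE XS // andbT; apply/negP => /sS; rewrite !inE xX.
Qed.

(** Both [t ++ s] and [S'] list the ground set of the minor; replacing one by the other in front of
    [X] produces the constant factor. *)
Lemma sign_minor s t : uniq s -> {subset s <= S :\: [set x in X]} ->
  lists t (S :\: [set x in X] :\: [set x in s]) ->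
  e (t ++ s ++ X) = e S' * e (S' ++ X) * e (t ++ s).
Proof.
move=> us sS tE; have tsE := lists_cat tE us sS.
rewrite catA -[RHS]mulrC mulrA; apply: sign_perm_catr (lists_perm tsE S'E).
by have [] := listsP tsE.
Qed.

Lemma minor_sign_sq : (e S' * e (S' ++ X)) * (e S' * e (S' ++ X)) = 1.
Proof.
have [uS' _] := listsP S'E; have [uSX _] := listsP (lists_cat S'E uX XS).
by rewrite mulrACA !sign_sq // mulr1.
Qed.

(** Both sides evaluate [u] at [t]; only the signs of [t ++ s] and [t ++ s ++ X] differ. *)
Lemma dual_delete : dual eps (S :\: [set x in X]) (delete S u X) =
  (e S' * e (S' ++ X)) *: contract S (dual eps S u) X.
Proof.
apply: (plucker_ext (S := S :\: [set x in X])).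
- exact: supported_dual.
- exact/supportedZ/supported_contract/supported_dual.
move=> s us sS; pose t := enum (S :\: [set x in X] :\: [set x in s]).
have tE : lists t (S :\: [set x in X] :\: [set x in s]) by apply: lists_enum.
have [ut tM] := listsP tE; have [_ sXS tS _] := lists_minor us sS tE.
rewrite (plucker_dual _ sS tE) pluckerZ plucker_contract // (plucker_dual _ sXS tS).
rewrite plucker_delete => [|x]; last by rewrite tM inE => /andP[].
rewrite (sign_minor us sS tE) mulrCA; congr (_ * _).
by rewrite [RHS]mulrA minor_sign_sq mul1r.
Qed.

(** Both sides evaluate [u] at [t ++ X]. In the sign of the dual on [S], [X] stands before [s], and
    moving it past [s] gives the extra power of -1. *)
Lemma dual_contract k : homogeneous k u ->
  dual eps (S :\: [set x in X]) (contract S u X) =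
  (e S' * e (S' ++ X) * (-1) ^+ (size X * (#|S| - k))) *:
    delete S (dual eps S u) X.
Proof.
move=> hu; apply: (plucker_ext (S := S :\: [set x in X])).
- exact: supported_dual.
- exact/supportedZ/supported_delete/supported_dual.
move=> s us sS; pose t := enum (S :\: [set x in X] :\: [set x in s]).
have tE : lists t (S :\: [set x in X] :\: [set x in s]) by apply: lists_enum.
have [ut tM] := listsP tE; have [sS0 sXS tS tXS] := lists_minor us sS tE.
rewrite (plucker_dual _ sS tE) pluckerZ plucker_delete // (plucker_dual _ sS0 tXS).
rewrite plucker_contract // => [|x]; last by rewrite tM inE => /andP[].
have [->|nz] := eqVneq (plucker u (t ++ X)) 0; first by rewrite !mul0r mulr0.
rewrite mulrCA; congr (_ * _).
(* The nonzero coordinate at [t ++ X] has length [k], which leaves [#|S| - k] elements for [s]. *)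
have -> : (#|S| - k)%N = size s.
  rewrite -(lists_size (lists_cat tXS us sS0)) size_cat.
  by rewrite (plucker_homogeneous hu nz) addKn.
rewrite -catA (alternating_swap X s (alternating_catl t sign_alternating)).
rewrite (sign_minor us sS tE) -[RHS]mulrA (mulrA (_ ^+ _)) -expr2 sqrr_sign.
by rewrite mul1r [RHS]mulrA minor_sign_sq mul1r.
Qed.

End Minors.

(** * The dual of a product over disjoint ground sets *)

Section DualProduct.
Variables (S1 S2 : {set T}) (u v : E).
Hypotheses (dS : [disjoint S1 & S2]) (su : supported S1 u) (sv : supported S2 v).

(** Puts the elements of [S1] first, the ordering on which [pluckerM] factors coordinates. *)
Lemma perm_filter_split s :
  perm_eq s ([seq x <- s | x \in S1] ++ [seq x <- s | x \notin S1]).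
Proof. by rewrite perm_sym; apply: permEl; apply: (perm_filterC (mem S1)). Qed.

(** With [s] split into [s1], [s2] and complements [t1], [t2], the power of -1 comes from exchanging
    [t2] and [s1] in [t1 ++ t2 ++ s1 ++ s2], after which the two halves list [S1] and [S2]. *)
Lemma dualM k l l1 l2 : homogeneous k u -> homogeneous l v ->
  lists l1 S1 -> lists l2 S2 ->
  dual eps (S1 :|: S2) (u * v) =
  (e l1 * e l2 * e (l1 ++ l2) * (-1) ^+ (rank (dual eps S1 u) * rank v)) *:
    (dual eps S1 u * dual eps S2 v).
Proof.
move=> hu hv l1E l2E; apply: (plucker_ext (S := S1 :|: S2)).
- exact: supported_dual.
- exact/supportedZ/supportedM/supported_dual/supported_dual.
move=> s us sS; apply: alternating_eq (perm_filter_split s) _;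
  try exact: plucker_alternating.
set s1 := filter _ s; set s2 := filter _ s.
have [us1 us2] : uniq s1 /\ uniq s2 by rewrite !filter_uniq.
have s1S : {subset s1 <= S1} by move=> x; rewrite mem_filter => /andP[].
have s2n x : x \in s2 -> x \notin S1 by rewrite mem_filter => /andP[].
have s2S : {subset s2 <= S2}.
  move=> x; rewrite mem_filter => /andP[nx /sS]; rewrite inE.
  by rewrite (negPf nx).
have not2 x : x \in S1 -> x \in S2 -> False.
  by move=> x1 x2; move/pred0P/(_ x): dS; rewrite /= x1 x2.
pose t1 := enum (S1 :\: [set x in s1]); pose t2 := enum (S2 :\: [set x in s2]).
have t1E : lists t1 (S1 :\: [set x in s1]) by apply: lists_enum.
have t2E : lists t2 (S2 :\: [set x in s2]) by apply: lists_enum.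
have [[ut1 t1M] [ut2 t2M]] := (listsP t1E, listsP t2E).
have t1S : {subset t1 <= S1} by move=> x; rewrite t1M inE => /andP[].
have t2n x : x \in t2 -> x \notin S1.
  by rewrite t2M inE => /andP[_ x2]; apply/negP => /not2; apply.
have sS12 : {subset s1 ++ s2 <= S1 :|: S2}.
  by move=> x; rewrite mem_cat inE => /orP[/s1S|/s2S] ->; rewrite ?orbT.
have tE : lists (t1 ++ t2) ((S1 :|: S2) :\: [set x in s1 ++ s2]).
  apply: lists_intro => [|x].
    rewrite cat_uniq ut1 ut2 andbT /=; apply/hasPn => x /t2n.
    by apply: contra => /t1S.
  rewrite mem_cat t1M t2M !inE mem_cat negb_or.
  case: (boolP (x \in S1)) => x1 /=.
    have -> : (x \in S2) = false by apply/negP => /(not2 x x1).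
    have -> : (x \in s2) = false by apply/negP => /s2n; rewrite x1.
    by rewrite !andbF orbF !andbT.
  by have -> : (x \in s1) = false by apply: contraNF x1 => /s1S.
rewrite (plucker_dual _ sS12 tE) pluckerZ (pluckerM dS su sv t1S t2n).
rewrite (pluckerM dS) //; [|exact: supported_dual..].
rewrite (plucker_dual _ s1S t1E) (plucker_dual _ s2S t2E).
(* If either coordinate vanishes both sides are 0; otherwise the two ranks in the exponent are
   [size s1] and [size t2]. *)
have [->|nz1] := eqVneq (plucker u t1) 0; first by rewrite !(mul0r, mulr0).
have [->|nz2] := eqVneq (plucker v t2) 0; first by rewrite !(mul0r, mulr0).
have unz : u != 0 by apply: contraNneq nz1 => ->; rewrite plucker0.
rewrite -(plucker_size hv nz2) (rank_dual su hu unz).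
have -> : (#|S1| - k)%N = size s1.
  rewrite -(lists_size (lists_cat t1E us1 s1S)) size_cat.
  by rewrite (plucker_homogeneous hu nz1) addKn.
have {}t1E := lists_cat t1E us1 s1S; have {}t2E := lists_cat t2E us2 s2S.
have ->: e ((t1 ++ t2) ++ s1 ++ s2) =
    (-1) ^+ (size s1 * size t2) * e ((t1 ++ s1) ++ (t2 ++ s2)).
  have alt := alternating_catl t1 (alternating_catr s2 sign_alternating).
  have := alternating_swap t2 s1 alt.
  by rewrite mulnC -!catA.
have [[u1 _] [u2 _]] := (listsP t1E, listsP t2E).
(* Each half is replaced by the prescribed listing [l1] or [l2], at the cost of the signs of both
   orderings. *)
rewrite (sign_perm_catr _ u1 (lists_perm t1E l1E)).
rewrite (sign_perm_catl _ u2 (lists_perm t2E l2E)).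
move: (plucker u t1) (plucker v t2) ((-1) ^+ _) => p q sg.
move: (e (t1 ++ s1)) (e (t2 ++ s2)) (e l1) (e l2) (e (l1 ++ l2)) => a b c d f.
ring.
Qed.

End DualProduct.
End Duals.

(** * Direct sums of matroids and of oriented matroids *)

Section DirectSums.
Variable T : finType.
Implicit Types (A B : {set T}) (s : seq T).

(** Over a domain, the coordinate of [u * v] at a union of two bases is, up to sign, a product of
    nonzero scalars. Conversely a nonzero coordinate has a nonzero term, which splits its set into
    two bases. *)
Lemma presents_dsum (K : idomainType) (S1 S2 : {set T}) (u v : exterior K T)
    (M1 M2 : matroid T) (dis : [disjoint mground M1 & mground M2]) :
  [disjoint S1 & S2] -> supported S1 u -> supported S2 v ->
  presents S1 u M1 -> presents S2 v M2 ->
  presents (S1 :|: S2) (u * v) (mdsum dis).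
Proof.
move=> dS su sv [g1 b1] [g2 b2]; split; first by rewrite /= g1 g2.
apply/setP => B; rewrite /= b1 b2 inE plucker_enum_eq0.
apply/imset2P/idP => [[B1 B2]|/ext_mul_neq0[C [sCB nC nBC]]]; last first.
  exists C (B :\: C); rewrite ?inE ?plucker_enum_eq0 //.
  by rewrite -{1}(setID B C) (setIidPr sCB).
rewrite !inE !plucker_enum_eq0 => n1 n2 ->.
have dB : [disjoint B2 & S1].
  by rewrite disjoint_sym; apply: disjointWr (sv _ n2) dS.
rewrite (ext_mulU dS su sv (su _ n1) dB).
by rewrite mulf_neq0 ?signr_eq0 // mulf_neq0.
Qed.

(** Makes the sign in [chi_dsum] trivial on the ordering where the chirotopes are compared. *)
Lemma nshuffle_filter A s :
  nshuffle A ([seq x <- s | x \in A] ++ [seq x <- s | x \notin A]) = 0%N.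
Proof.
rewrite nshuffle_cat; set s1 := filter _ s; set s2 := filter _ s.
have c1 : count (predC (mem A)) s1 = 0%N.
  by rewrite count_filter (eq_count (a2 := pred0)) ?count_pred0 // => x /=;
    rewrite andNb.
have c2 : count (mem A) s2 = 0%N.
  by rewrite count_filter (eq_count (a2 := pred0)) ?count_pred0 // => x /=;
    rewrite andbN.
rewrite c1 mul0n addn0.
have -> : nshuffle A s1 = 0%N.
  by elim: (s1) c1 => //= x r IH /eqP; rewrite addn_eq0 => /andP[];
    case: (x \in A) => //= _ /eqP/IH ->.
elim: (s2) c2 => //= x r IH /eqP; rewrite addn_eq0 => /andP[_ /eqP c].
by rewrite c muln0 IH.
Qed.

Lemma sgz_plucker_alternating (K : realFieldType) (u : exterior K T) :
  alternating (fun s => sgz (plucker u s)).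
Proof.
have [alt1 alt2] := plucker_alternating u.
by split=> [s /alt1 ->|s x y t]; rewrite ?sgz0 // alt2 sgzN.
Qed.

(** With the elements of [S1] first, both the sign of the coordinate of [u * v] and the chirotope of
    the sum are plain products; alternation carries the equality to every ordering. *)
Lemma opresents_dsum (K : realFieldType) (S1 S2 : {set T}) (u v : exterior K T)
    (M1 M2 : oriented_matroid T) (dis : [disjoint oground M1 & oground M2]) :
  [disjoint S1 & S2] -> supported S1 u -> supported S2 v ->
  opresents S1 u M1 -> opresents S2 v M2 ->
  opresents (S1 :|: S2) (u * v) (odsum dis).
Proof.
move=> dS su sv [g1 [b1 c1]] [g2 [b2 c2]]; split; first by rewrite /= g1 g2.
(* Each chirotope is determined up to a global sign, and the two global signs multiply. *)
exists (b1 (+) b2) => s; rewrite signr_addb.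
pose f s : int := (-1) ^+ b1 * (-1) ^+ b2 * chirotope (odsum dis) s.
have altf : alternating f.
  have [alt1 alt2] := chirotope_alternating (odsum dis).
  by split=> [r /alt1 e|r x y t]; rewrite /f ?e ?mulr0 // alt2 mulrN.
apply: (alternating_eq (sgz_plucker_alternating (u * v)) altf
         (perm_filter_split S1 s)).
rewrite /f /= /chi_dsum g1 nshuffle_filter mul1r !filter_cat !filter_id.
have -> : [seq x <- [seq x <- s | x \notin S1] | x \in S1] = [::].
  by rewrite -filter_predI (eq_filter (a2 := pred0)) ?filter_pred0 // => x /=;
    rewrite andbN.
have -> : [seq x <- [seq x <- s | x \in S1] | x \notin S1] = [::].
  by rewrite -filter_predI (eq_filter (a2 := pred0)) ?filter_pred0 // => x /=;
    rewrite andNb.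
rewrite cats0 (pluckerM dS su sv).
- by rewrite sgzM c1 c2 mulrACA.
- by move=> x; rewrite mem_filter => /andP[].
- by move=> x; rewrite mem_filter => /andP[].
Qed.

End DirectSums.

(** * The duality formulas for extensors, with degrees turned into ranks *)

Theorem theorem13 (T : finType) (eps : seq T -> int)
    (Heps : orientation eps) :
  (forall K : fieldType,
    [/\ (forall (S : {set T}) (N1 N2 : exterior K T),
           extensor S N1 -> extensor S N2 -> extensor S (N1 + N2) ->
           dual eps S (N1 + N2) = dual eps S N1 + dual eps S N2)
        /\
        (forall (S : {set T}) (N : exterior K T) (alpha : K),
           extensor S N ->
           dual eps S (alpha *: N) = alpha *: dual eps S N),

        (forall (S : {set T}) (N : exterior K T),
           extensor S N ->
           dual eps S (dual eps S N)
             = (-1) ^+ (rank N * (#|S| - rank N)) *: N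
           /\
           dual eps S (dual eps S N)
             = (-1) ^+ (rank N * rank (dual eps S N)) *: N),

        (forall (S : {set T}) (N : exterior K T) (X S' : seq T),
           extensor S N -> uniq X -> {subset X <= S} ->
           lists S' (S :\: [set x in X]) ->
           dual eps (S :\: [set x in X]) (delete S N X)
             = (eps S' * eps (S' ++ X))%:~R *: contract S (dual eps S N) X
           /\
           dual eps (S :\: [set x in X]) (contract S N X)
             = ((eps S' * eps (S' ++ X))%:~R
                * (-1) ^+ (size X * (#|S| - rank N)))
               *: delete S (dual eps S N) X)
      & (forall (S1 S2 : {set T}) (N1 N2 : exterior K T),
           [disjoint S1 & S2] -> extensor S1 N1 -> extensor S2 N2 ->
           [/\ extensor (S1 :|: S2) (N1 * N2),
               (forall (M1 M2 : matroid T)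
                       (dis : [disjoint mground M1 & mground M2]),
                  presents S1 N1 M1 -> presents S2 N2 M2 ->
                  presents (S1 :|: S2) (N1 * N2) (mdsum dis))
             & (forall s1 s2 : seq T, lists s1 S1 -> lists s2 S2 ->
                  dual eps (S1 :|: S2) (N1 * N2)
                    = ((eps s1 * eps s2 * eps (s1 ++ s2))%:~R
                       * (-1) ^+ (rank (dual eps S1 N1) * rank N2))
                      *: (dual eps S1 N1 * dual eps S2 N2))])])
  /\
  (forall (K : realFieldType) (S1 S2 : {set T}) (N1 N2 : exterior K T),
     [disjoint S1 & S2] -> extensor S1 N1 -> extensor S2 N2 ->
     forall (M1 M2 : oriented_matroid T)
            (dis : [disjoint oground M1 & oground M2]),
       opresents S1 N1 M1 -> opresents S2 N2 M2 ->
       opresents (S1 :|: S2) (N1 * N2) (odsum dis)).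
Proof.
have supp (K : fieldType) (S : {set T}) (N : exterior K T) :
  extensor S N -> supported S N by move=> extN A; apply: extensor_supp extN.
split=> [K|K S1 S2 N1 N2 dS ext1 ext2 M1 M2 dis]; last first.
  exact: (opresents_dsum dis dS (supp _ _ _ ext1) (supp _ _ _ ext2)).
split.
- by split=> [S N1 N2 _ _ _|S N a _]; [apply: dualD | apply: dualZ].
- move=> S N extN; have [k hk] := extensor_homogeneous extN.
  (* The degree [k] is the rank for nonzero [N]; for [N = 0] all the terms vanish. *)
  have sN := supp _ _ _ extN; have [->|nz] := eqVneq N 0.
    by rewrite !dual0 !scaler0.
  by rewrite (rank_dual Heps sN hk nz) (rank_homogeneous hk nz) (dualK Heps sN hk).
- move=> S N X S' extN uX XS S'E; have [k hk] := extensor_homogeneous extN.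
  have sN := supp _ _ _ extN; rewrite intrM; split; first exact: dual_delete.
  rewrite (dual_contract Heps uX XS S'E hk).
  (* For [N = 0] the exponents given by [k] and by the rank may differ, but both sides are 0. *)
  have [->|nz] := eqVneq N 0; last by rewrite (rank_homogeneous hk nz).
  by rewrite dual0 delete0 !scaler0.
move=> S1 S2 N1 N2 dS ext1 ext2.
have [[k hk] [l hl]] := (extensor_homogeneous ext1, extensor_homogeneous ext2).
have [s1 s2] := (supp _ _ _ ext1, supp _ _ _ ext2); split.
- exact: extensorM (extensorS (subsetUl _ _) ext1) (extensorS (subsetUr _ _) ext2).
- by move=> M1 M2 dis; apply: presents_dsum.
by move=> l1 l2 l1E l2E; rewrite !intrM; apply: dualM hk hl l1E l2E.
Qed.
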